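(* Let $M\ge0$ be fixed. Let $A_n(\lambda)$ be the polynomials defined by $A_0(\lambda)=1$, $A_1(\lambda)=\lambda-\frac{1+2M}{1+M}$ and $A_n(\lambda)=(\lambda-2)A_{n-1}(\lambda)-A_{n-2}(\lambda)$ for $n\ge2$, let $\mu_{1,n}$ be the smallest zero of $A_n$, and let $M_n=1/\sqrt{\mu_{1,n}}$ be the Markov-Bernstein constant. Then, as $n\to\infty$, $$\mu_{1,n}=O\Big(\frac1{n^2}\Big)\qquad\text{and}\qquad M_n=O(n).$$
   Context: The zeros of $A_n$ are real and positive. $M_n$ is the constant in the Markov-Bernstein inequality $c_1((p')^2)\le M_n^2\,c_0(p^2)$ for real polynomials $p$ of degree at most $n$, where $c_0(p)=\int_0^\infty p(x)e^{-x}dx+Mp(0)$ and $c_1(p)=\int_0^\infty p(x)e^{-x}dx$. The parameter $M$ is unrelated to the constants $M_n$. *)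

(* Defs.v *)
From mathcomp Require Import all_boot all_order all_algebra.
From mathcomp Require Import all_classical all_reals all_analysis.
Import Order.TTheory GRing.Theory Num.Theory.
Import numFieldNormedType.Exports.

Set Implicit Arguments.
Unset Strict Implicit.
Unset Printing Implicit Defensive.

Local Open Scope classical_set_scope.
Local Open Scope ring_scope.

Fixpoint polyA (R : realType) (M : R) (n : nat) {struct n} : {poly R} :=
  match n with
  | 0%N => 1
  | n'.+1 =>
    match n' with
    | 0%N => 'X - ((1 + 2 * M) / (1 + M))%:P
    | n''.+1 => ('X - 2%:P) * polyA M n' - polyA M n''
    end
  end.

(* All the zeros of polyA M n are real when 0 <= M, so it is enough to compare
   with the zeros in R. *)
Definition is_smallest_zero (R : realType) (p : {poly R}) (x : R) : Prop :=
  root p x /\ forall y : R, root p y -> x <= y.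

Definition c1 (R : realType) (p : {poly R}) : R :=
  Rintegral (@lebesgue_measure R) `[0, +oo[ (fun x => p.[x] * expR (- x)).

Definition c0 (R : realType) (M : R) (p : {poly R}) : R :=
  c1 p + M * p.[0].

Definition markov_bernstein (R : realType) (M : R) (n : nat) (C : R) : Prop :=
  forall p : {poly R}, (size p <= n.+1)%N ->
    c1 (p^`() ^+ 2) <= C ^+ 2 * c0 M (p ^+ 2).

Definition is_markov_bernstein_constant (R : realType) (M : R) (n : nat)
    (C : R) : Prop :=
  [/\ 0 <= C, markov_bernstein M n C &
      forall C' : R, 0 <= C' -> markov_bernstein M n C' -> C <= C'].

(* Main.v *)
From HB Require Import structures.
Require Import Defs.
From mathcomp Require Import all_boot all_order all_algebra.
From mathcomp Require Import all_classical all_reals all_analysis.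
From mathcomp Require Import measurable_realfun ring lra.
Import Order.TTheory GRing.Theory Num.Theory.
Import numFieldNormedType.Exports.

(* The Laguerre polynomials L_k are orthonormal for c1, satisfy L_k(0) = 1 and
   (L_k - L_(k+1))' = L_k.  Hence a polynomial of degree at most n is
   p = a + \sum_(k < n) b_k (L_k - L_(k+1)), with c1 (p'^2) = \sum_k b_k^2 and,
   setting b_n = 0,
     c0 (p^2) = M a^2 + (a + b_0)^2 + \sum_(k < n) (b_(k+1) - b_k)^2.
   Minimising over a gives the quadratic form of a Jacobi matrix J_n whose
   characteristic polynomial is A_n.  Its smallest eigenvalue mu has the
   positive eigenvector v_k = (-1)^k A_k(mu), and completing squares along v
   yields the sharp bound mu * c1 (p'^2) <= c0 (p^2), i.e. M_n^2 = 1 / mu.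
   Testing the form on b_k = k (n - k) gives mu <= 10 / n^2, and the discrete
   Cauchy-Schwarz inequality gives mu >= 1 / n^2. *)

Set Implicit Arguments.
Unset Strict Implicit.
Unset Printing Implicit Defensive.

Local Open Scope classical_set_scope.
Local Open Scope ring_scope.

(** * Moments of the weight e^(-x) on the half-line *)

Section Moments.
Variable R : realType.
Implicit Types (p q : {poly R}) (k n : nat).

(** Squeezed under (k+1)!/x, because e^x >= x^(k+1)/(k+1)! for x >= 0. *)
Lemma cvg_exprn_expRN k : (x ^+ k * expR (- x)) @[x --> +oo] --> (0 : R).
Proof.
apply: (@squeeze_cvgr _ _ _ _ (fun=> 0) (fun x : R => (k.+1)`!%:R * x^-1)).
- near=> x.
  have x0 : 0 < x by near: x; exact: nbhs_pinfty_gt.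
  rewrite mulr_ge0 ?expR_ge0 ?exprn_ge0 ?(ltW x0)//=.
  have := @expR_ge1Dxn R x k (ltW x0).
  rewrite expRN => xe.
  have f0 : 0 < (k.+1)`!%:R :> R by rewrite ltr0n fact_gt0.
  rewrite ler_pdivrMr ?expR_gt0// -mulrA [x^-1 * _]mulrC mulrA ler_pdivlMr//.
  rewrite -exprSr -ler_pdivrMl// mulrC; apply: le_trans xe.
  by rewrite lerDr.
- exact: cvg_cst.
- rewrite -(mulr0 (k.+1)`!%:R); apply: cvgMr.
  apply/gtr0_cvgV0; last exact: cvg_id.
  exact: nbhs_pinfty_gt.
Unshelve. all: by end_near. Qed.

Lemma cvg_horner_expRN p : (p.[x] * expR (- x)) @[x --> +oo] --> (0 : R).
Proof.
have -> : (fun x => p.[x] * expR (- x)) =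
    (fun x => \sum_(i < size p) p`_i * (x ^+ i * expR (- x))).
  apply/funext => x; rewrite horner_coef mulr_suml.
  by apply: eq_bigr => i _; rewrite mulrA.
have E : \sum_(i < size p) p`_i * 0 = 0 :> R by rewrite big1// => i _; rewrite mulr0.
rewrite -[X in _ --> X]E; apply: (@cvg_big _ _ _ _ _ add_continuous) => i _.
by apply: cvgMr; exact: cvg_exprn_expRN.
Qed.

Lemma continuous_horner_expRN p : continuous (fun x : R => p.[x] * expR (- x)).
Proof.
move=> x; apply: cvgM; first exact: continuous_horner.
by apply: continuous_comp; [exact: cvgN|exact: continuous_expR].
Qed.

Lemma is_derive_horner_expRN p (x : R) :
  is_derive x 1 (fun x : R => - (p.[x] * expR (- x))) ((p - p^`()).[x] * expR (- x)).
Proof.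
apply: is_derive_eq.
rewrite /GRing.scale/= hornerD hornerN; ring.
Qed.

(** Then - p e^(-x) is an antiderivative of x^k e^(-x), so p(0) is the k-th moment, with no iterated
    integration by parts. *)
Lemma exists_subr_deriv_Xn k : exists2 p : {poly R}, p - p^`() = 'X^k & p.[0] = k`!%:R.
Proof.
elim: k => [|k [p pE p0]].
  by exists 1; rewrite ?derivC ?subr0 ?hornerC// -polyC1 derivC subr0.
exists ('X^(k.+1) + k.+1%:R *: p).
  rewrite derivD derivXn derivZ /= -pE.
  by rewrite mulrnBl !scaler_nat subrK addrK.
rewrite !hornerE p0 expr0n add0r. by rewrite factS natrM.
Qed.

Lemma integral_exprn_expRN k :
  (\int[@lebesgue_measure R]_(x in `[0%R, +oo[) (x ^+ k * expR (- x))%:E)%E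
  = (k`!%:R)%:E.
Proof.
have [p pE p0] := exists_subr_deriv_Xn k.
have E x : x ^+ k * expR (- x) = (p - p^`()).[x] * expR (- x).
  by rewrite pE hornerXn.
rewrite (@ge0_continuous_FTC2y R _ (fun x => - (p.[x] * expR (- x))) 0 0).
- by rewrite sub0e oppr0 expR0 mulr1 p0 EFinN oppeK.
- by move=> x x0; rewrite mulr_ge0 ?exprn_ge0 ?expR_ge0.
- apply: continuous_subspaceT => x.
  under [X in continuous_at _ X]funext do rewrite E.
  exact: continuous_horner_expRN.
- rewrite -oppr0; apply: cvgN; exact: cvg_horner_expRN.
- by move=> x _; case: (is_derive_horner_expRN p x).
- apply: cvg_at_right_filter; apply: cvgN; exact: continuous_horner_expRN.
- move=> x _; rewrite derive1E E.
  by case: (is_derive_horner_expRN p x).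
Qed.

Lemma integrable_exprn_expRN k :
  (@lebesgue_measure R).-integrable `[0%R, +oo[
    (EFin \o (fun x => x ^+ k * expR (- x))).
Proof.
apply/integrableP; split.
  apply/measurable_EFinP; apply: measurable_funTS.
  apply: continuous_measurable_fun => x.
  have -> : (fun x : R => x ^+ k * expR (- x)) = (fun x : R => 'X^k.[x] * expR (- x)).
    by apply/funext => y; rewrite hornerXn.
  exact: continuous_horner_expRN.
rewrite (_ : integral _ _ _ = (k`!%:R)%:E) ?ltry// -integral_exprn_expRN.
apply: eq_integral => x; rewrite inE /= in_itv /= andbT => x0.
by rewrite ger0_norm// mulr_ge0 ?exprn_ge0 ?expR_ge0.
Qed.

(** Turns the integral into the algebraic functional X^i -> i!, from which linearity and [c1_deriv]
    follow. *)
Lemma c1E p : c1 p = \sum_(i < size p) p`_i * i`!%:R.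
Proof.
have intZ i : (@lebesgue_measure R).-integrable `[0%R, +oo[
    (EFin \o (fun x => p`_i * (x ^+ i * expR (- x)))).
  exact: integrableZl (integrable_exprn_expRN i).
rewrite /c1 /Rintegral; under eq_integral => x _.
  rewrite horner_coef mulr_suml; under eq_bigr do rewrite -mulrA.
  rewrite -sumEFin; over.
rewrite integral_sum//=; last by move=> i; exact: intZ.
rewrite (eq_bigr (fun i : 'I_(size p) => (p`_i * i`!%:R)%:E)).
  by rewrite sumEFin.
move=> i _; under eq_integral do rewrite EFinM.
rewrite integralZl ?integral_exprn_expRN//; exact: integrable_exprn_expRN.
Qed.

End Moments.

(** * Laguerre polynomials and expansions in them *)

Section Laguerre.
Variable R : realType.
Implicit Types (p q : {poly R}) (b : nat -> R) (k n : nat).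

Lemma c1E_le p n : (size p <= n)%N -> c1 p = \sum_(i < n) p`_i * i`!%:R.
Proof.
move=> pn; rewrite c1E (big_ord_widen _ (fun i => p`_i * i`!%:R) pn) big_mkcond.
apply: eq_bigr => i _; case: ltnP => // le.
by rewrite nth_default// mul0r.
Qed.

Lemma c1_is_linear (a : R) p q : c1 (a *: p + q) = a * c1 p + c1 q.
Proof.
 pose n := maxn (size p) (size q).
have pn : (size p <= n)%N := leq_maxl _ _.
have qn : (size q <= n)%N := leq_maxr _ _.
have apn : (size (a *: p) <= n)%N := leq_trans (size_scale_leq _ _) pn.
have apqn : (size (a *: p + q)%R <= n)%N.
  by rewrite (leq_trans (size_polyD _ _))// geq_max apn.
rewrite (c1E_le pn) (c1E_le qn) (c1E_le apqn) mulr_sumr -big_split.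
by apply: eq_bigr => i _; rewrite coefD coefZ mulrDl mulrA.
Qed.

HB.instance Definition _ := GRing.isLinear.Build R {poly R} R^o _ (@c1 R) (c1_is_linear : linear (@c1 R : {poly R} -> R^o)).

(** Integration by parts against e^(-x), on coefficients: (i+1) i! = (i+1)!. *)
Lemma c1_deriv p : c1 p^`() = c1 p - p.[0].
Proof.
have sd : (size p^`() <= size p)%N.
  have [->|/lt_size_deriv/ltnW//] := eqVneq p 0; by rewrite deriv0.
rewrite (c1E_le sd) (c1E_le (leqnSn _)) big_ord_recl horner_coef0 fact0 mulr1.
rewrite /= addrAC subrr add0r; apply: eq_bigr => i _.
by rewrite coef_deriv /bump leq0n add1n factS natrM -(mulr_natr p`_i.+1) mulrA.
Qed.

(** At index 0 the coefficient is a quotient by 0, hence 0 by convention: this is the primitive that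
    vanishes at 0. *)
Definition primitive p : {poly R} := \poly_(i < (size p).+1) (p`_i.-1 / i%:R).

Lemma coef_primitive p i : (primitive p)`_i = p`_i.-1 / i%:R.
Proof.
rewrite coef_poly; case: ltnP => // le; rewrite nth_default ?mul0r//.
by rewrite -ltnS prednK// (leq_trans _ le).
Qed.

Lemma deriv_primitive p : (primitive p)^`() = p.
Proof.
apply/polyP => i; rewrite coef_deriv coef_primitive /= -(mulr_natr (p`_i / _)).
by rewrite divfK ?pnatr_eq0.
Qed.

Lemma horner0_primitive p : (primitive p).[0] = 0.
Proof. by rewrite horner_coef0 coef_primitive invr0 mulr0. Qed.

Lemma size_primitive_le p : (size (primitive p) <= (size p).+1)%N.
Proof. exact: size_poly. Qed.

(** Integrating from 0 builds in L_k(0) = 1 and (L_k - L_(k+1))' = L_k. *)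
Fixpoint laguerre k : {poly R} :=
  if k is k'.+1 then laguerre k' - primitive (laguerre k') else 1.

Lemma laguerreB k : laguerre k - laguerre k.+1 = primitive (laguerre k).
Proof. by rewrite /= subKr. Qed.

Lemma laguerre0 k : (laguerre k).[0] = 1.
Proof.
elim: k => [|k IHk] /=; first by rewrite hornerC.
by rewrite hornerD hornerN horner0_primitive subr0.
Qed.

Lemma size_laguerre_le k : (size (laguerre k) <= k.+1)%N.
Proof.
elim: k => [|k IHk] /=; first by rewrite size_poly1.
rewrite (leq_trans (size_polyD _ _))// size_polyN geq_max (leq_trans IHk)//.
by rewrite (leq_trans (size_primitive_le _)).
Qed.

Lemma laguerre_coef_neq0 k : (laguerre k)`_k != 0.
Proof.
elim: k => [|k IHk] /=; first by rewrite coefC oner_eq0.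
rewrite coefB coef_primitive /= nth_default ?size_laguerre_le// sub0r oppr_eq0.
by rewrite mulf_neq0// invr_eq0 pnatr_eq0.
Qed.

Lemma deriv_laguerre k : (laguerre k)^`() = - \sum_(i < k) laguerre i.
Proof.
elim: k => [|k IHk]; first by rewrite big_ord0 oppr0 /= derivC.
by rewrite big_ord_recr /= derivB deriv_primitive IHk opprD.
Qed.

(** Induction on j + k: c1 (L_j L_k) = 1 + c1 ((L_j L_k)') by [c1_deriv], and the derivative expands
    into products of smaller index sum, which contribute -[k < j] - [j < k]. *)
Lemma c1_laguerreM j k : c1 (laguerre j * laguerre k) = (j == k)%:R.
Proof.
have [n] := ubnP (j + k); elim: n j k => // n IHn j k jkn.
have := c1_deriv (laguerre j * laguerre k).
rewrite derivM hornerM !laguerre0 mulr1 !deriv_laguerre.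
rewrite mulNr mulrN mulr_suml mulr_sumr linearD !linearN !linear_sum /=.
have sum_delta i m : (i + m < n.+1)%N ->
    \sum_(l < i) c1 (laguerre l * laguerre m) = (m < i)%:R.
  move=> imn; rewrite (eq_bigr (fun l : 'I_i => (l == m :> nat)%:R)); last first.
    by move=> l _; apply: IHn; rewrite -ltnS (leq_trans _ imn)// !ltnS ltn_add2r.
  have [mi|im] := ltnP m i.
    rewrite (bigD1 (Ordinal mi))//= eqxx big1 ?addr0// => l lm.
    by move: lm; rewrite -val_eqE => /negbTE ->.
  by rewrite big1// => l _; rewrite ltn_eqF// (leq_trans _ im).
rewrite !sumrN (eq_bigr (fun i : 'I_k => c1 (laguerre i * laguerre j)) (fun i _ => congr1 (@c1 R) (mulrC _ _))).
rewrite !sum_delta//; last by rewrite addnC.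
case: ltngtP => _ /=; lra.
Qed.

Lemma c1_sqr_laguerre b n :
  c1 ((\sum_(k < n) b k *: laguerre k) ^+ 2) = \sum_(k < n) b k ^+ 2.
Proof.
rewrite expr2 mulr_suml linear_sum /=; apply: eq_bigr => i _.
rewrite mulr_sumr linear_sum (bigD1 i)//= big1 => [|j ji].
  rewrite -scalerAl -scalerAr !linearZ /= c1_laguerreM eqxx addr0.
  by rewrite /GRing.scale /=; ring.
rewrite -scalerAl -scalerAr !linearZ /= c1_laguerreM.
by rewrite eq_sym (inj_eq val_inj) (negbTE ji) !scaler0.
Qed.

(** The primitive of L_n has degree exactly n+1, so a multiple of it removes the top coefficient; it
    vanishes at 0, so p(0) is unaffected. *)
Lemma laguerre_expansion p n : (size p <= n.+1)%N ->
  exists b, p = p.[0]%:P + \sum_(k < n) b k *: (laguerre k - laguerre k.+1).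
Proof.
elim: n p => [|n IHn] p pn.
  by exists (fun=> 0); rewrite big_ord0 addr0 {1}(size1_polyC pn) horner_coef0.
pose c := p`_n.+1 / (primitive (laguerre n))`_n.+1.
pose q := p - c *: primitive (laguerre n).
have l0 : (primitive (laguerre n))`_n.+1 != 0.
  by rewrite coef_primitive mulf_neq0 ?laguerre_coef_neq0// invr_eq0 pnatr_eq0.
have qn : (size q <= n.+1)%N.
  apply/leq_sizeP => j; rewrite leq_eqVlt => /predU1P[<-|nj].
    by rewrite coefB coefZ divfK// subrr.
  rewrite coefB coefZ !nth_default ?mulr0 ?subrr//.
    by rewrite (leq_trans (size_primitive_le _))// (leq_trans _ nj)// ltnS size_laguerre_le.
  exact: leq_trans pn _.
have [b qE] := IHn q qn.
exists (fun k => if k == n then c else b k).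
rewrite big_ord_recr /= eqxx laguerreB addrA.
have -> : p.[0] = q.[0] by rewrite hornerD hornerN hornerZ horner0_primitive mulr0 subr0.
rewrite (eq_bigr (fun k : 'I_n => b k *: (laguerre k - laguerre k.+1))) => [|k _].
  by rewrite -qE subrK.
by rewrite ltn_eqF.
Qed.

Lemma deriv_laguerre_expansion a b n :
  (a%:P + \sum_(k < n) b k *: (laguerre k - laguerre k.+1))^`() =
  \sum_(k < n) b k *: laguerre k.
Proof.
rewrite derivD derivC add0r linear_sum; apply: eq_bigr => k _.
by rewrite /= derivZ laguerreB deriv_primitive.
Qed.

Lemma sum_by_parts (V : lmodType R) b (L : nat -> V) n :
  \sum_(k < n) b k *: (L k - L k.+1) =
  b 0%N *: L 0%N + \sum_(k < n) (b k.+1 - b k) *: L k.+1 - b n *: L n.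
Proof.
elim: n => [|n IHn]; first by rewrite !big_ord0 addr0 subrr.
rewrite !big_ord_recr /= IHn scalerBr scalerBl addrA subrK -!addrA.
by do 2 congr (_ + _); rewrite addrCA subrr addr0.
Qed.

Lemma c1_sqr_laguerre_expansion a b n : b n = 0 ->
  c1 ((a%:P + \sum_(k < n) b k *: (laguerre k - laguerre k.+1)) ^+ 2) =
  (a + b 0%N) ^+ 2 + \sum_(k < n) (b k.+1 - b k) ^+ 2.
Proof.
move=> bn0; rewrite sum_by_parts bn0 scale0r subr0 addrA -alg_polyC -scalerDl.
pose d k := if k is k'.+1 then b k'.+1 - b k' else a + b 0%N.
have -> : (a + b 0%N) *: 1 + \sum_(k < n) (b k.+1 - b k) *: laguerre k.+1 =
    \sum_(k < n.+1) d k *: laguerre k by rewrite big_ord_recl.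
by rewrite c1_sqr_laguerre big_ord_recl.
Qed.

End Laguerre.

(** * Signs and zeros of A_n through its recurrence *)

Section Jacobi.
Variables (R : realType) (M : R).
Hypothesis M_ge0 : 0 <= M.
Implicit Types (p : {poly R}) (x mu : R) (b : nat -> R) (k m n : nat).

Let M1_gt0 : 0 < 1 + M. Proof. by move: M_ge0 => ?; lra. Qed.

Let MM1_ge0 : 0 <= M / (1 + M). Proof. by rewrite divr_ge0// ltW. Qed.

(* [vA mu k] is the k-th leading principal minor of J_n - mu. *)
Definition vA mu k : R := (-1) ^+ k * (polyA M k).[mu].

Lemma vA0 mu : vA mu 0 = 1.
Proof. by rewrite /vA expr0 mul1r /= hornerC. Qed.

Lemma vA1 mu : vA mu 1 = 1 + M / (1 + M) - mu.
Proof. by have M1 := M1_gt0; rewrite /vA /= !hornerE; field; rewrite gt_eqF. Qed.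

Lemma vASS mu k : vA mu k.+2 = (2 - mu) * vA mu k.+1 - vA mu k.
Proof.
rewrite /vA.
have -> : polyA M k.+2 = ('X - 2%:P) * polyA M k.+1 - polyA M k by [].
by rewrite hornerD hornerN hornerM hornerXsubC !exprS; ring. Qed.

Lemma polyA_root mu k : root (polyA M k) mu = (vA mu k == 0).
Proof. by rewrite /vA mulf_eq0 signr_eq0. Qed.

Lemma vA_gt0_le0 mu k : mu <= 0 -> 0 < vA mu k.
Proof.
(* Monotonicity in k carries the induction: v_(k+2) - v_(k+1) = (v_(k+1) - v_k) - mu v_(k+1). *)
move=> mu0; suff: 0 < vA mu k /\ vA mu k <= vA mu k.+1 by case.
have MM := MM1_ge0.
elim: k => [|k [vk vle]]; first by rewrite vA0 vA1; split; lra.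
rewrite vASS; split; first lra.
have : 0 <= - mu * vA mu k.+1 by apply: mulr_ge0; lra.
lra.
Qed.

Lemma vA_ivt k x : vA x k <= 0 -> exists2 y, 0 < y <= x & root (polyA M k) y.
Proof.
move=> vx.
have x0 : 0 < x by rewrite ltNge; apply/negP => /(vA_gt0_le0 k); rewrite ltNge vx.
(* Negated because [poly_ivt] wants a nonpositive value at the left end, while [vA 0 k] is
   positive. *)
pose p := - ((-1) ^+ k *: polyA M k).
have pE y : p.[y] = - vA y k by rewrite /p hornerN hornerZ.
have [||y /andP[y0 yx]] := @poly_ivt R p 0 x; first exact: ltW.
  by rewrite !pE oppr_le0 oppr_ge0 vx ltW// vA_gt0_le0.
rewrite /root pE oppr_eq0 -polyA_root => ry.
exists y => //; rewrite yx andbT lt_neqAle y0 andbT.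
apply/eqP => y_eq0; move: ry; rewrite -y_eq0 polyA_root.
by rewrite gt_eqF// vA_gt0_le0.
Qed.

(** Induction on the size: if a root lies below x, divide out X - x; the quotient has the same roots
    away from x. *)
Lemma exists_smallest_root p x : p != 0 -> root p x ->
  exists2 y, y <= x & root p y /\ forall z, z < y -> ~~ root p z.
Proof.
have [n] := ubnP (size p); elim: n p x => // n IHn p x sp p0 rx.
have [[y yx ry]|nr] := pselect (exists2 y, y < x & root p y); last first.
  exists x => //; split=> // z zx; apply/negP => rz; apply: nr.
  by exists z.
have /factor_theorem[q pE] := rx.
have q0 : q != 0 by apply: contraNneq p0 => q0; rewrite pE q0 mul0r.
have rq z : z != x -> root p z = root q z.
  by move=> zx; rewrite pE rootM root_XsubC (negbTE zx) orbF.
have sq : (size q < n)%N.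
  by move: sp; rewrite pE size_Mmonic ?monicXsubC// size_XsubC addn2.
rewrite rq ?lt_eqF// in ry.
have [z zy [rz zmin]] := IHn q y sq q0 ry.
exists z; first exact: le_trans (ltW yx).
split=> [|w wz]; first by rewrite rq// lt_eqF// (le_lt_trans zy).
by rewrite rq ?zmin// lt_eqF// (lt_trans wz)// (le_lt_trans zy).
Qed.

Lemma polyA_neq0 k : polyA M k != 0.
Proof.
apply/eqP => p0; have := @vA_gt0_le0 0 k (lexx _).
by rewrite /vA p0 horner0 mulr0 ltxx.
Qed.

(* Interlacing: at the smallest zero w of A_(n+1) the recurrence gives
   vA w n.+2 = - vA w n < 0, so A_(n+2) has a zero below w. *)
Lemma vA_gt0_below_roots n x : (forall y, y < x -> ~~ root (polyA M n) y) ->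
  forall k, (k < n)%N -> 0 < vA x k.
Proof.
elim: n x => // n IHn x xP.
suff vn y : y <= x -> 0 < vA y n.
  move=> k; rewrite ltnS leq_eqVlt => /predU1P[->|]; first exact: vn.
  by apply: IHn => y yx; rewrite polyA_root gt_eqF// vn// ltW.
move=> yx; rewrite ltNge; apply/negP => /vA_ivt[z /andP[z0 zy] rz].
have [w wz [rw wmin]] := @exists_smallest_root _ _ (polyA_neq0 n) rz.
have vw := IHn w wmin.
case: n {IHn rz wmin} xP rw vw => [|n] xP rw vw.
  by move: rw; rewrite polyA_root vA0 oner_eq0.
have := vw n (leqnn _); move: rw; rewrite polyA_root => /eqP rw vn0.
have /vA_ivt[u /andP[_ uw] ru] : vA w n.+2 <= 0 by rewrite vASS rw; lra.
move: uw; rewrite le_eqVlt => /predU1P[uw|uw].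
  move: ru; rewrite uw polyA_root vASS rw => /eqP; lra.
by have := xP u (lt_le_trans uw (le_trans wz (le_trans zy yx))); rewrite ru.
Qed.

(* The minimum over a of M a^2 + (a + b_0)^2 is M / (1 + M) * b_0^2. *)
Definition energy b m : R :=
  M / (1 + M) * b 0%N ^+ 2 + \sum_(k < m) (b k.+1 - b k) ^+ 2.

Lemma energyS b m : energy b m.+1 = energy b m + (b m.+1 - b m) ^+ 2.
Proof. by rewrite /energy big_ord_recr addrA. Qed.

(** * The Jacobi form at the smallest zero: sharp bound and eigenvector *)

Section SmallestZero.
Variables (n : nat) (mu : R).
Hypothesis muP : is_smallest_zero (polyA M n.+1) mu.

Lemma vA_gt0 k : (k <= n)%N -> 0 < vA mu k.
Proof.
move=> kn; apply: (@vA_gt0_below_roots n.+1) => // y ymu; apply/negP => /(muP.2).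
by rewrite leNgt ymu.
Qed.

Lemma vA_eq0 : vA mu n.+1 = 0.
Proof. by apply/eqP; rewrite -polyA_root; case: muP. Qed.

Lemma smallest_zero_gt0 : 0 < mu.
Proof.
rewrite ltNge; apply/negP => /(vA_gt0_le0 n.+1).
by rewrite vA_eq0 ltxx.
Qed.

(** Gaussian elimination on J - mu, whose pivots are the ratios vA_(m+1) / vA_m. The truncated form
    lacks (1 - mu) b_m^2 of the full diagonal term, hence the correction - 1 + mu. *)
Lemma energy_partial_ge b m : (m <= n)%N ->
  (vA mu m.+1 / vA mu m - 1 + mu) * b m ^+ 2
    <= energy b m - mu * \sum_(k < m) b k ^+ 2.
Proof.
elim: m => [_|m IHm mn].
  by rewrite /energy !big_ord0 vA1 vA0 mulr0 subr0 addr0 divr1; nra.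
have v0 := vA_gt0 (ltnW mn); have v1 := vA_gt0 mn.
have := IHm (ltnW mn); rewrite energyS big_ord_recr /= vASS.
set w := vA mu m.+1 / vA mu m => IH.
have w0 : 0 < w by rewrite divr_gt0.
have -> : ((2 - mu) * vA mu m.+1 - vA mu m) / vA mu m.+1 = 2 - mu - w^-1.
  by rewrite /w; field; rewrite !gt_eqF.
(* The square split off when b_m is eliminated with pivot w. *)
have : 0 <= (w * b m - b m.+1) ^+ 2 / w by rewrite divr_ge0 ?sqr_ge0// ltW.
have -> : (w * b m - b m.+1) ^+ 2 / w =
  w * b m ^+ 2 - 2 * b m * b m.+1 + b m.+1 ^+ 2 * w^-1 by field; rewrite gt_eqF.
nra.
Qed.

(** The last pivot is 0 because mu is a zero of A_(n+1), so J - mu is positive semidefinite. *)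
Lemma energy_ge b : b n.+1 = 0 ->
  mu * \sum_(k < n.+1) b k ^+ 2 <= energy b n.+1.
Proof.
move=> b0; have := energy_partial_ge b (leqnn n).
rewrite energyS big_ord_recr /= vA_eq0 b0 mul0r; nra.
Qed.

Lemma energy_vA : energy (vA mu) n.+1 = mu * \sum_(k < n.+1) vA mu k ^+ 2.
Proof.
(* By the recurrence the remainder has a closed form at every truncation m; it vanishes at m = n+1
   by [vA_eq0]. *)
suff E m : energy (vA mu) m - mu * \sum_(k < m) vA mu k ^+ 2
    = vA mu m * vA mu m.+1 - (1 - mu) * vA mu m ^+ 2.
  by apply/eqP; rewrite -subr_eq0 E vA_eq0 mul0r expr0n mulr0 subr0.
elim: m => [|m IHm]; first by rewrite /energy !big_ord0 vA1 vA0; ring.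
rewrite energyS big_ord_recr vASS /=.
move/eqP: IHm; rewrite subr_eq => /eqP ->; ring.
Qed.

Lemma sum_vA_gt0 : 0 < \sum_(k < n.+1) vA mu k ^+ 2.
Proof.
rewrite big_ord_recl vA0 expr1n ltr_wpDr//.
by apply: sumr_ge0 => i _; exact: sqr_ge0.
Qed.

End SmallestZero.

(** * Bounds of order 1/n^2 for the smallest zero *)

Lemma sqr_sum_le (f : nat -> R) m :
  (f m - f 0%N) ^+ 2 <= m%:R * \sum_(j < m) (f j.+1 - f j) ^+ 2.
Proof.
elim: m => [|m IHm]; first by rewrite subrr expr0n mul0r.
case: m IHm => [|m] IHm; first by rewrite big_ord1 mul1r.
rewrite big_ord_recr /=; move: IHm.
set S := \sum_(_ < _) _; set D := f m.+1 - f 0%N.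
have -> : f m.+2 - f 0%N = D + (f m.+2 - f m.+1) by rewrite /D; ring.
set d := f m.+2 - f m.+1; rewrite [m.+2%:R]mulrS.
set t : R := m.+1%:R => IH.
have t0 : 0 < t by rewrite ltr0n.
(* Multiplied by t, the gap is at least (D - t d)^2 once D^2 <= t S is used: Cauchy-Schwarz by
   induction. *)
rewrite -subr_ge0 -(pmulr_rge0 _ t0).
have := sqr_ge0 (D - t * d); nra.
Qed.

(** Since b_n = 0, each - b_k is the sum of the increments from k to n, so b_k^2 <= n E; summing
    over n indices gives the second factor n. *)
Lemma sum_sqr_le_energy b n : b n = 0 ->
  \sum_(k < n) b k ^+ 2 <= n%:R ^+ 2 * energy b n.
Proof.
move=> b0.
have MM : 0 <= M / (1 + M) * b 0%N ^+ 2.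
  by rewrite mulr_ge0 ?sqr_ge0.
set E := energy b n.
suff le k : (k < n)%N -> b k ^+ 2 <= n%:R * E.
  apply: (@le_trans _ _ (\sum_(k < n) n%:R * E)).
    by apply: ler_sum => k _; exact: le.
  by rewrite sumr_const card_ord -[(_ * _) *+ n]mulr_natl mulrA.
move=> kn; have := @sqr_sum_le (fun j => b (k + j)%N) (n - k)%N.
rewrite /= subnKC 1?ltnW// b0 addn0 sub0r sqrrN => /le_trans; apply.
have sub : \sum_(j < n - k) (b (k + j.+1)%N - b (k + j)%N) ^+ 2 <= E.
  apply: (@le_trans _ _ (\sum_(j < n) (b j.+1 - b j) ^+ 2)); last by rewrite /E /energy lerDr.
  rewrite -(big_mkord xpredT (fun j => (b j.+1 - b j) ^+ 2)).
  rewrite (@big_cat_nat _ _ _ k)//= 1?ltnW//.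
  rewrite (_ : \sum_(k <= i < n) _ =
      \sum_(j < n - k) (b (k + j.+1)%N - b (k + j)%N) ^+ 2); last first.
    rewrite -{1}[k]add0n big_addn big_mkord.
    by apply: eq_bigr => j _; rewrite addnS addnC.
  by rewrite lerDr; apply: sumr_ge0 => i _; exact: sqr_ge0.
apply: ler_pM => //; first by apply: sumr_ge0 => i _; exact: sqr_ge0.
by rewrite ler_nat leq_subr.
Qed.

Lemma smallest_zero_ge n mu : is_smallest_zero (polyA M n.+1) mu ->
  1 / n.+1%:R ^+ 2 <= mu.
Proof.
move=> muP; have := @sum_sqr_le_energy (vA mu) n.+1 (vA_eq0 muP).
rewrite energy_vA// mulrA -{1}[X in X <= _]mul1r ler_pM2r ?sum_vA_gt0// => le.
by rewrite ler_pdivrMr ?exprn_gt0 ?ltr0n// mulrC.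
Qed.

(** x is kept apart from m so that the induction on m leaves it fixed; at m = x the sum is x (x^4 -
    1) / 30. *)
Lemma sum_sqr_parabola (x : R) m :
  \sum_(k < m) (k%:R * (x - k%:R)) ^+ 2 =
  m%:R * (m%:R - 1) * (2 * m%:R - 1) * x ^+ 2 / 6
  - m%:R ^+ 2 * (m%:R - 1) ^+ 2 * x / 2
  + m%:R * (m%:R - 1) * (2 * m%:R - 1) * (3 * m%:R ^+ 2 - 3 * m%:R - 1) / 30.
Proof.
elim: m => [|m IHm]; first by rewrite big_ord0; field.
by rewrite big_ord_recr /= IHm mulrS; field.
Qed.

(** At m = x the sum is x (x^2 - 1) / 3. *)
Lemma sum_sqr_diff_parabola (x : R) m :
  \sum_(k < m) (k.+1%:R * (x - k.+1%:R) - k%:R * (x - k%:R)) ^+ 2 =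
  m%:R * (x - 1) ^+ 2 - 2 * (x - 1) * m%:R * (m%:R - 1)
  + 4 * (m%:R * (m%:R - 1) * (2 * m%:R - 1) / 6).
Proof.
elim: m => [|m IHm]; first by rewrite big_ord0; field.
by rewrite big_ord_recr /= IHm mulrS; field.
Qed.

Lemma smallest_zero_le n mu : is_smallest_zero (polyA M n.+1) mu ->
  (0 < n)%N -> mu <= 10 / n.+1%:R ^+ 2.
Proof.
move=> muP n0.
pose x : R := n.+1%:R.
(* Zero at both ends: b_(n+1) = 0 is required by [energy_ge], and b_0 = 0 removes M from the
   energy. *)
pose b k : R := k%:R * (x - k%:R).
have x2 : 2 <= x by rewrite ler_nat ltnS.
have := @energy_ge n mu muP b _; rewrite {1}/b subrr mulr0 => /(_ erefl).
rewrite /energy sum_sqr_parabola sum_sqr_diff_parabola {1}/b mul0r expr0n mulr0 add0r.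
rewrite -/x => le.
have mu0 := smallest_zero_gt0 muP.
(* Dividing by this common factor leaves mu (x^2 + 1) <= 10. *)
have xp : 0 < x * (x ^+ 2 - 1) by apply: mulr_gt0; nra.
have le2 : x * (x ^+ 2 - 1) * (mu * (x ^+ 2 + 1)) <= x * (x ^+ 2 - 1) * 10 by lra.
rewrite ler_pM2l// in le2.
rewrite ler_pdivlMr; nra.
Qed.

End Jacobi.

(** * From the quadratic form to the Markov-Bernstein constant *)

Lemma c0_sqr_laguerre_expansion (R : realType) (M a : R) (b : nat -> R) n :
  0 <= M -> b n = 0 ->
  c0 M ((a%:P + \sum_(k < n) b k *: (laguerre R k - laguerre R k.+1)) ^+ 2) =
  energy M b n + (1 + M) * (a + b 0%N / (1 + M)) ^+ 2.
Proof.
move=> M0 bn0; rewrite /c0 c1_sqr_laguerre_expansion// horner_exp hornerD.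
rewrite hornerC horner_sum [X in M * (a + X) ^+ 2]big1 => [|k _]; last first.
  by rewrite /= hornerZ laguerreB horner0_primitive mulr0.
(* Completing the square in a: M a^2 + (a + b_0)^2 = M/(1+M) b_0^2 + (1+M) (a + b_0/(1+M))^2. *)
rewrite /energy; field; rewrite gt_eqF// ltr_wpDr//.
Qed.

(** One direction makes 1/sqrt(mu) admissible, the other shows that no smaller nonnegative constant
    is. *)
Lemma markov_bernstein_smallest_zero (R : realType) (M mu : R) n : 0 <= M ->
  is_smallest_zero (polyA M n.+1) mu ->
  forall C, markov_bernstein M n.+1 C <-> mu^-1 <= C ^+ 2.
Proof.
move=> M0 muP C; have mu0 := smallest_zero_gt0 M0 muP.
have M1 : 0 < 1 + M by rewrite ltr_wpDr.
split=> [MB|muC p pn]; last first.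
  have [b0 pE] := laguerre_expansion pn.
  (* The expansion leaves b_(n+1) arbitrary, while the energy bound needs it to be 0. *)
  pose b k := if (k < n.+1)%N then b0 k else 0.
  have {}pE : p = p.[0]%:P + \sum_(k < n.+1) b k *: (laguerre R k - laguerre R k.+1).
    rewrite {1}pE; congr (_ + _); apply: eq_bigr => k _.
    by rewrite /b ltn_ord.
  have bn : b n.+1 = 0 by rewrite /b ltnn.
  rewrite pE deriv_laguerre_expansion c1_sqr_laguerre c0_sqr_laguerre_expansion//.
  have S0 : 0 <= \sum_(k < n.+1) b k ^+ 2.
    by apply: sumr_ge0 => k _; exact: sqr_ge0.
  have := energy_ge M0 muP bn; rewrite -ler_pdivlMl// => /le_trans; apply.
  have E0 : 0 <= energy M b n.+1.
    by rewrite (le_trans _ (energy_ge M0 muP bn))// mulr_ge0// ltW.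
  apply: (le_trans (ler_wpM2r E0 muC)); rewrite ler_wpM2l ?sqr_ge0//.
  by rewrite lerDl mulr_ge0 ?sqr_ge0// ltW.
(* The extremal polynomial: eigenvector coefficients, and the constant that cancels the completed
   square in [c0_sqr_laguerre_expansion]. *)
pose b := vA M mu.
pose p : {poly R} := (- (b 0%N / (1 + M)))%:P +
  \sum_(k < n.+1) b k *: (laguerre R k - laguerre R k.+1).
have pn : (size p <= n.+2)%N.
  rewrite (leq_trans (size_polyD _ _))// geq_max (leq_trans (size_polyC_leq1 _))//=.
  rewrite (leq_trans (size_sum _ _ _))//; apply/bigmax_leqP => k _.
  rewrite (leq_trans (size_scale_leq _ _))// laguerreB.
  rewrite (leq_trans (size_primitive_le _))// ltnS.
  by rewrite (leq_trans (size_laguerre_le _ _)).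
have bn : b n.+1 = 0 := vA_eq0 muP.
have := MB p pn.
rewrite deriv_laguerre_expansion c1_sqr_laguerre c0_sqr_laguerre_expansion//.
rewrite addNr expr0n mulr0 addr0 energy_vA// mulrA.
rewrite -{1}[X in X <= _]mul1r ler_pM2r ?sum_vA_gt0//.
by rewrite -ler_pdivrMr// div1r.
Qed.

Theorem corollary2p14 (R : realType) (M : R) (M_ge0 : 0 <= M)
    (mu1 Mn : nat -> R^o)
    (mu1P : forall n : nat, (0 < n)%N -> is_smallest_zero (polyA M n) (mu1 n))
    (MnP : forall n : nat, (0 < n)%N ->
             is_markov_bernstein_constant M n (Mn n)) :
  [/\ forall n : nat, (0 < n)%N -> Mn n = 1 / Num.sqrt (mu1 n),
      mu1 =O_\oo (fun n : nat => 1 / n%:R ^+ 2 : R^o) &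
      Mn =O_\oo (fun n : nat => n%:R : R^o)].
Proof.
have MnE n : (0 < n)%N -> Mn n = 1 / Num.sqrt (mu1 n).
  case: n => // n _.
  have [C0 MB Cmin] := MnP n.+1 isT.
  have muP := mu1P n.+1 isT; have mu0 := smallest_zero_gt0 M_ge0 muP.
  have iff := markov_bernstein_smallest_zero M_ge0 muP.
  have sq : (1 / Num.sqrt (mu1 n.+1)) ^+ 2 = (mu1 n.+1)^-1.
    by rewrite div1r exprVn sqr_sqrtr// ltW.
  have s0 : 0 <= 1 / Num.sqrt (mu1 n.+1) by rewrite divr_ge0 ?sqrtr_ge0.
  apply/eqP; rewrite eq_le Cmin//=; last by apply/iff; rewrite sq.
  by rewrite -(ler_pXn2r (n := 2))// sq; apply/iff.
split=> //.
  (* The constant 10 and the threshold 2 come from [smallest_zero_le], which needs degree at least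
     2. *)
  apply/eqO_exP; exists 10; first by rewrite ltr0n.
  exists 2%N => // -[|[|n]] //= _.
  have muP := mu1P n.+2 isT.
  rewrite (ger0_norm (ltW (smallest_zero_gt0 M_ge0 muP))).
  rewrite ger0_norm ?divr_ge0 ?exprn_ge0// div1r.
  exact: smallest_zero_le muP _.
(* The upper bound on [Mn] is the lower bound mu >= 1/n^2 inverted. *)
apply/eqO_exP; exists 1; first by rewrite ltr01.
exists 1%N => // -[|n] //= _.
have muP := mu1P n.+1 isT; have mu0 := smallest_zero_gt0 M_ge0 muP.
rewrite MnE// div1r mul1r normfV !ger0_norm ?sqrtr_ge0//.
rewrite invf_ple ?posrE ?sqrtr_gt0 ?ltr0n//.
have n0 : 0 <= n.+1%:R^-1 :> R by rewrite invr_ge0.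
rewrite -(ger0_norm n0) -sqrtr_sqr ler_wsqrtr// exprVn -div1r.
exact: smallest_zero_ge muP.
Qed.
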